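(* Let $\zeta\ge1$, let $\bm{X}_1,\dots,\bm{X}_{\zeta+1}$, $\bm{Y}_1,\dots,\bm{Y}_\zeta$ be complex $n\times n$ matrices, and let $f,\beta_1,\dots,\beta_\zeta$ be functions of $\zeta+1$ variables for which the GMOIs $T_f^{\bm{X}_1,\dots,\bm{X}_{\zeta+1}}$ and $T_{\beta_i}^{\bm{X}_1,\dots,\bm{X}_{\zeta+1}}$ are defined. Write $[\bm{X}]_1^{\zeta+1}$ for the list $\bm{X}_1,\dots,\bm{X}_{\zeta+1}$ and $[\bm{Y}]_1^{\zeta}$ for the list $\bm{Y}_1,\dots,\bm{Y}_\zeta$. Then $$T_{f \prod_{i=1}^{\zeta}\beta_i}^{\bm{X}_1,[\bm{X}]_1^{\zeta+1},\bm{X}_2,[\bm{X}]_1^{\zeta+1},\ldots,[\bm{X}]_1^{\zeta+1},\bm{X}_{\zeta+1}}\big(\underbrace{\bm{I},[\bm{Y}]^{\zeta}_1, \bm{I},\ \ldots,\ \bm{I},[\bm{Y}]^{\zeta}_1,\bm{I}}_{\zeta \text{ blocks } \bm{I},[\bm{Y}]_1^\zeta,\bm{I}}\big)=T_{f}^{\bm{X}_1,\ldots,\bm{X}_{\zeta+1}}\big(T_{\beta_1}^{\bm{X}_1,\ldots,\bm{X}_{\zeta+1}}(\bm{Y}_1,\ldots,\bm{Y}_{\zeta}),\ldots,T_{\beta_\zeta}^{\bm{X}_1,\ldots,\bm{X}_{\zeta+1}}(\bm{Y}_1,\ldots,\bm{Y}_{\zeta})\big).$$ The left-hand side is a GMOI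 with $(\zeta+1)^2$ parameter matrices. Here $f\prod_{i=1}^\zeta\beta_i$ is the function of $(\zeta+1)^2$ variables $(z_1,w_1,z_2,w_2,\dots,w_\zeta,z_{\zeta+1})$, with $z_p$ scalar and $w_i=(w_{i,1},\dots,w_{i,\zeta+1})$, given by $f(z_1,\dots,z_{\zeta+1})\prod_{i=1}^\zeta\beta_i(w_{i,1},\dots,w_{i,\zeta+1})$.
   Context: Jordan data: every complex $n\times n$ matrix $\bm{X}_p$ is written as $\bm{X}_p=\sum_{k_p=1}^{K_p}\sum_{i_p=1}^{\alpha^{\mathrm G}_{k_p}}\left(\lambda_{k_p}\bm{P}_{k_p,i_p}+\bm{N}_{k_p,i_p}\right)$, where $\lambda_{k_p}$ are the $K_p$ distinct eigenvalues, $\alpha^{\mathrm G}_{k_p}$ is the geometric multiplicity of $\lambda_{k_p}$ (the number of its Jordan blocks), $\bm{P}_{k_p,i_p}$ is the projector onto the invariant subspace of the $i_p$-th Jordan block of $\lambda_{k_p}$ (so $\sum_{k_p,i_p}\bm{P}_{k_p,i_p}=\bm{I}$), and $\bm{N}_{k_p,i_p}$ is the nilpotent part of that block, of order $m_{k_p,i_p}$ (i.e. $\bm{N}_{k_p,i_p}^{\ell}=\bm{0}$ for $\ell\ge m_{k_p,i_p}$). Put $\bm{S}^{(0)}_{k_p,i_p}=\bm{P}_{k_p,i_p}$ and $\bm{S}^{(q)}_{k_p,i_p}=\bm{N}_{k_p,i_p}^{q}$ for $q\ge1$. Generalized multiple operator integral (GMOI), with any number $r+1$ of parameter matrices: for $\beta$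 analytic in a polydisc $|z_l|<R_l$ ($l=1,\dots,r+1$) with all eigenvalues of $\bm{X}_l$ of modulus $<R_l$, $$T_{\beta}^{\bm{X}_1,\ldots,\bm{X}_{r+1}}(\bm{Y}_1,\ldots,\bm{Y}_{r})=\sum_{k_1,\dots,k_{r+1}}\sum_{i_1,\dots,i_{r+1}}\sum_{q_1=0}^{m_{k_1,i_1}-1}\cdots\sum_{q_{r+1}=0}^{m_{k_{r+1},i_{r+1}}-1}\frac{\beta^{(q_1,\dots,q_{r+1})}(\lambda_{k_1},\dots,\lambda_{k_{r+1}})}{q_1!\cdots q_{r+1}!}\,\bm{S}^{(q_1)}_{k_1,i_1}\bm{Y}_1\bm{S}^{(q_2)}_{k_2,i_2}\bm{Y}_2\cdots\bm{Y}_r\bm{S}^{(q_{r+1})}_{k_{r+1},i_{r+1}},$$ where $\beta^{(q_1,\dots,q_{r+1})}$ is the partial derivative of order $q_l$ in the $l$-th variable. *)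

(* Defs.v *)
From HB Require Import structures.
From mathcomp Require Import all_boot all_order all_algebra finmap complex.
From mathcomp Require Import all_classical all_reals all_analysis.
From mathcomp.analysis.showcase Require summability.

Set Implicit Arguments.
Unset Strict Implicit.
Unset Printing Implicit Defensive.

Import Order.TTheory GRing.Theory Num.Theory.
Import numFieldNormedType.Exports.

Local Open Scope ring_scope.
Local Open Scope classical_set_scope.

(* The scalar field K below is meant to be the complex numbers R[i],
   R : realType; keeping it abstract makes the generic topology of a
   numFieldType available. *)

Section Analytic.
Variables (K : numFieldType) (m : nat).
Implicit Types (b : 'rV[K]_m -> K) (rho : 'I_m -> K).

(* The order on R[i] only compares numbers with the same imaginary part, so
   `|z 0 l| < rho l` forces rho l to be real and positive. *)
Definition polydisc rho : set 'rV[K]_m :=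
  [set z | forall l, `|z 0 l| < rho l].

(* Around every point of D, b is the sum of a power series; the multiple
   series converges unconditionally, i.e. along the finite sets of
   multi-indices ordered by inclusion. *)
Definition analytic_on (D : set 'rV[K]_m) b : Prop :=
  forall z, D z -> exists a : {ffun 'I_m -> nat} -> K, exists2 eps : K, 0 < eps &
    forall h : 'rV[K]_m, (forall l, `|h 0 l| < eps) ->
      summability.partial_sum
        (fun al : {ffun 'I_m -> nat} => a al * \prod_l h 0 l ^+ al l)
        @ summability.totally --> b (z + h).

Definition partial (l : 'I_m) b : 'rV[K]_m -> K :=
  fun z => 'D_(delta_mx 0 l) b z.

(* b^(q_1,...,q_m); for analytic b the order of differentiation is
   irrelevant. *)
Definition partials (q : 'I_m -> nat) b : 'rV[K]_m -> K :=
  foldr (fun l g => iter (q l) (partial l) g) b (enum 'I_m).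

End Analytic.

Section Jordan.
Variables (K : numFieldType) (n : nat).

(* P and N restrict to one Jordan block of size m: the columns of U form a
   Jordan chain, the rows of V are the corresponding coordinate forms. *)
Definition jordan_block (m : nat) (P N : 'M[K]_n) : Prop :=
  exists (U : 'M[K]_(n, m)) (V : 'M[K]_(m, n)),
    [/\ V *m U = 1%:M, P = U *m V
      & N = U *m (\matrix_(a, c) (a.+1 == c)%:R) *m V].

Record jordan_data (X : 'M[K]_n) := JordanData {
  jnum : nat;
  jval : 'I_jnum -> K;
  jgeo : 'I_jnum -> nat;
  jord : forall k, 'I_(jgeo k) -> nat;
  jproj : forall k, 'I_(jgeo k) -> 'M[K]_n;
  jnil : forall k, 'I_(jgeo k) -> 'M[K]_n;
  jval_inj : injective jval;
  jval_eigen : forall a, eigenvalue X a <-> exists k, a = jval k;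
  jgeoE : forall k, jgeo k = \rank (eigenspace X (jval k));
  jord_gt0 : forall k (i : 'I_(jgeo k)), (0 < jord i)%N;
  jblock : forall k (i : 'I_(jgeo k)),
    jordan_block (jord i) (jproj i) (jnil i);
  jorth : forall k (i : 'I_(jgeo k)) k' (i' : 'I_(jgeo k')),
    Tagged (fun k => 'I_(jgeo k)) i != Tagged (fun k => 'I_(jgeo k)) i' ->
    jproj i *m jproj i' = 0;
  jproj_sum : \sum_k \sum_(i < jgeo k) jproj i = 1%:M;
  jdecomp : X = \sum_k \sum_(i < jgeo k) (jval k *: jproj i + jnil i)
}.

Section Index.
Variables (X : 'M[K]_n) (J : jordan_data X).

(* The triples (k, i, q) with q < m_{k,i}. *)
Definition jindex : finType :=
  {k : 'I_(jnum J) & {i : 'I_(jgeo k) & 'I_(jord i)}}.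

Implicit Type s : jindex.

Definition jlambda s : K := jval (tag s).
Definition jexp s : nat := tagged (tagged s).
Definition jS s : 'M[K]_n :=
  let i := tag (tagged s) in
  if jexp s == 0%N then jproj i else jnil i ^+ jexp s.

End Index.
End Jordan.

Section GMOI.
Variables (K : numFieldType) (n r : nat) (X : 'I_r.+1 -> 'M[K]_n).

Definition gmoi_defined (b : 'rV[K]_r.+1 -> K) : Prop :=
  exists2 rho : 'I_r.+1 -> K, analytic_on (polydisc rho) b &
    forall l a, eigenvalue (X l) a -> `|a| < rho l.

(* One sum over families s = (k_l, i_l, q_l)_l replaces the nested sums over
   the k_l, the i_l and the q_l. *)
Definition gmoi (J : forall l, jordan_data (X l)) (b : 'rV[K]_r.+1 -> K)
    (Y : 'I_r -> 'M[K]_n) : 'M[K]_n :=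
  \sum_(s : {dffun forall l : 'I_r.+1, jindex (J l)})
    (partials (fun l => jexp (s l)) b (\row_l jlambda (s l))
       / \prod_l (jexp (s l))`!%:R)
    *: (jS (s ord0) * \prod_(l < r) (Y l * jS (s (lift ord0 l)))).

End GMOI.

Arguments gmoi {K n r} X J b Y.

Section Composition.
Variable d : nat.

(* The list 1,[1..d+1],2,[1..d+1],...,d,[1..d+1],d+1 of parameter indices
   (counted from 0), of length (d+1)^2 = d(d+2)+1. *)
Definition comp_params : seq 'I_d.+1 :=
  rcons (flatten [seq widen_ord (leqnSn d) i :: enum 'I_d.+1 | i <- enum 'I_d])
    ord_max.

Definition comp_param (l : 'I_(d * d.+2).+1) : 'I_d.+1 :=
  nth ord0 comp_params l.

(* d blocks I, Y_1, ..., Y_d, I. *)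
Definition comp_args (K : numFieldType) n (Y : 'I_d -> 'M[K]_n) :
    seq 'M[K]_n :=
  flatten [seq 1%:M :: rcons [seq Y j | j <- enum 'I_d] 1%:M | _ <- enum 'I_d].

Definition comp_arg (K : numFieldType) n (Y : 'I_d -> 'M[K]_n)
    (l : 'I_(d * d.+2)) : 'M[K]_n :=
  nth 1%:M (comp_args Y) l.

(* Positions of the variables z_p and w_(i,j) in
   (z_1, w_1, z_2, w_2, ..., w_d, z_(d+1)). *)
Definition zpos (p : 'I_d.+1) : 'I_(d * d.+2).+1 := inord (p * d.+2).
Definition wpos (i : 'I_d) (j : 'I_d.+1) : 'I_(d * d.+2).+1 :=
  inord (i * d.+2 + j.+1).

Definition comp_fun (K : numFieldType) (f : 'rV[K]_d.+1 -> K)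
    (b : 'I_d -> 'rV[K]_d.+1 -> K) : 'rV[K]_(d * d.+2).+1 -> K :=
  fun v => f (\row_p v 0 (zpos p)) * \prod_(i < d) b i (\row_j v 0 (wpos i j)).

Lemma size_comp_params : size comp_params = (d * d.+2).+1.
Proof.
rewrite size_rcons size_flatten /shape -map_comp.
rewrite (eq_map (g := fun=> d.+2)) => [|i]; last by rewrite /= size_enum_ord.
by rewrite sumnE big_map big_const_seq count_predT size_enum_ord iter_addn_0
  mulnC.
Qed.

Lemma comp_params_sqr : (d * d.+2).+1 = (d.+1 ^ 2)%N.
Proof. by rewrite -mulnn mulSn mulnS addSn. Qed.

Lemma size_comp_args (K : numFieldType) n (Y : 'I_d -> 'M[K]_n) :
  size (comp_args Y) = (d * d.+2)%N.
Proof.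
rewrite size_flatten /shape -map_comp.
rewrite (eq_map (g := fun=> d.+2)) => [|i]; last first.
  by rewrite /= size_rcons size_map size_enum_ord.
by rewrite sumnE big_map big_const_seq count_predT size_enum_ord iter_addn_0
  mulnC.
Qed.

Lemma nth_flatten_const (S T : Type) (x0 : T) (i0 : S) (g : S -> seq T)
    (s : seq S) (c k j : nat) :
  (forall i, size (g i) = c) -> (k < size s)%N -> (j < c)%N ->
  nth x0 (flatten [seq g i | i <- s]) (k * c + j) = nth x0 (g (nth i0 s k)) j.
Proof.
move=> szg; elim: s k => [|i s IHs] [|k]//= ks jc; rewrite nth_cat szg.
  by rewrite mul0n add0n jc.
by rewrite mulSn -addnA ltnNge leq_addr /= addKn IHs.
Qed.

Lemma comp_param_zpos (p : 'I_d.+1) : comp_param (zpos p) = p.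
Proof.
rewrite /comp_param /zpos inordK; last first.
  by rewrite ltnS leq_pmul2r// -ltnS.
have szf : size (flatten [seq widen_ord (leqnSn d) i :: enum 'I_d.+1
                         | i <- enum 'I_d]) = (d * d.+2)%N.
  by apply: succn_inj; rewrite -size_comp_params size_rcons.
rewrite nth_rcons szf ltn_pmul2r// eqn_pmul2r//.
case: ltngtP => [pd|dp|pd].
- rewrite -[(p * _)%N]addn0.
  rewrite (nth_flatten_const _ (Ordinal pd) (c := d.+2))//=; last 2 first.
  + by move=> i /=; rewrite size_enum_ord.
  + by rewrite size_enum_ord.
  by apply: val_inj; rewrite /= nth_enum_ord.
- by have := ltn_ord p; rewrite ltnS leqNgt dp.
- exact: val_inj.
Qed.

Lemma comp_param_wpos (i : 'I_d) (j : 'I_d.+1) : comp_param (wpos i j) = j.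
Proof.
have lt_w : (i * d.+2 + j.+1 < d * d.+2)%N.
  apply: (@leq_trans (i.+1 * d.+2)); last by rewrite leq_pmul2r.
  by rewrite mulSn addnC ltn_add2r ltnS.
rewrite /comp_param /wpos inordK; last exact: ltnW.
have szf : size (flatten [seq widen_ord (leqnSn d) i :: enum 'I_d.+1
                         | i <- enum 'I_d]) = (d * d.+2)%N.
  by apply: succn_inj; rewrite -size_comp_params size_rcons.
rewrite nth_rcons szf lt_w (nth_flatten_const _ i (c := d.+2)) ?ltnS//.
- by rewrite /= nth_ord_enum.
- by move=> k /=; rewrite size_enum_ord.
- by rewrite size_enum_ord.
- by rewrite -ltnS.
Qed.

End Composition.

(* Main.v *)
Require Import Defs.
From HB Require Import structures.
From mathcomp Require Import all_boot all_order all_algebra finmap complex.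
From mathcomp Require Import all_classical all_reals all_analysis.
From mathcomp Require Import zify.

(* The argument lists match block by block: the word
   S_{z_1} I S_{w_{1,1}} Y_1 ... Y_zeta S_{w_{1,zeta+1}} I S_{z_2} I ...
   is S_{z_1} M_1 S_{z_2} M_2 ... with M_i the i-th inner word, so the identity
   follows by distributivity once the coefficients factor. They do because the
   blocks of variables are disjoint: a partial derivative in one block treats
   the other factors as constants. *)

Set Implicit Arguments.
Unset Strict Implicit.
Unset Printing Implicit Defensive.

Import Order.TTheory GRing.Theory Num.Theory.
Import numFieldNormedType.Exports.

Local Open Scope ring_scope.
Local Open Scope complex_scope.

(** * Iterated partial derivatives of products over disjoint blocks of variables *)

Section Partials.
Variable K : numFieldType.

(* No convergence is required, since lim is 0 on a divergent filter; hence the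
   derivatives below factor even where they are junk values. *)
Lemma lim_scale (T : Type) (F : set_system T) (c : K) (g : T -> K) :
  ProperFilter F ->
  lim ((c * g x) @[x --> F])%classic = c * lim (g x @[x --> F])%classic.
Proof.
(* For [c = 0] the scaled function converges even if [g] diverges, so the divergent case below needs
   [c != 0]. *)
move=> FF; have [->|c0] := eqVneq c 0.
  rewrite mul0r; under eq_fun do rewrite mul0r.
  by rewrite lim_cst.
have [cvg_g|dvg_g] := pselect (cvg (g x @[x --> F])%classic).
  by apply: cvg_lim => //; exact: (@cvgMl_tmp _ _ _ _ _ c _ cvg_g).
have -> : lim (g x @[x --> F])%classic = 0 by rewrite (dvgP dvg_g).
rewrite mulr0; apply: (@dvgP _ (_ @ F)%classic); apply: contra_not dvg_g.
by rewrite -(is_cvgMlE_tmp g c0).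
Qed.

(** Since [c] is constant along the [l]-th axis, [c v] factors out of each difference quotient at
    [v], then out of the limit. *)
Lemma partialM_cst (N : nat) (l : 'I_N) (c b : 'rV[K]_N -> K) :
  (forall h v, c (h *: delta_mx 0 l + v) = c v) ->
  partial l (fun v => c v * b v) = fun v => c v * partial l b v.
Proof.
move=> cP; apply/funext => v; rewrite /partial /derive -lim_scale.
apply: (congr1 (fun g : K -> K => lim (g @ 0^'))%classic).
apply/funext => h /=.
by rewrite cP -mulrBr scalerAr.
Qed.

Variables (N m : nat).

(** By injectivity of [pos], a step along axis [pos j] moves the extracted row along axis [j] alone,
    so the difference quotients coincide. *)
Lemma partial_rowsub (pos : 'I_m -> 'I_N) (j : 'I_m) (b : 'rV[K]_m -> K) :
  injective pos ->
  partial (pos j) (fun v => b (\row_k v 0 (pos k))) =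
  fun v => partial j b (\row_k v 0 (pos k)).
Proof.
move=> pos_inj; apply/funext => v; rewrite /partial /derive.
apply: (congr1 (fun g : K -> K => lim (g @ 0^'))%classic).
apply/funext => h /=.
congr (_ *: (b _ - _)).
by apply/rowP => k; rewrite !mxE /= (inj_eq pos_inj).
Qed.

Variables (G : finType) (pos : G -> 'I_m -> 'I_N) (inv : 'I_N -> G * 'I_m).
Hypothesis posK : forall g j, inv (pos g j) = (g, j).
Hypothesis invK : forall l, pos (inv l).1 (inv l).2 = l.
Hypothesis pos_lt : forall g (j k : 'I_m), (j < k)%N -> (pos g j < pos g k)%N.

Let pos_inj g : injective (pos g).
Proof. by move=> j k /(congr1 inv); rewrite !posK => -[]. Qed.

Let coord (g : G) (l : 'I_N) : option 'I_m :=
  if (inv l).1 == g then Some (inv l).2 else None.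

(* Monotonicity of pos g makes the derivatives within a block occur in the order
   prescribed by partials; for arbitrary functions they need not commute. *)
Let pmap_coord_enum g : pmap (coord g) (enum 'I_N) = enum 'I_m.
Proof.
(* Mapped through [pos g], both sides are strictly increasing lists of the variables of block
   [g]. *)
apply: (inj_map (@pos_inj g)); rewrite (@pmap_filter _ _ (coord g)); last first.
  by move=> l; rewrite /coord; case: eqP => //= <-; rewrite invK.
apply: (@irr_sorted_eq _ (fun l k : 'I_N => (l < k)%N)).
- by move=> ? ? ?; apply: ltn_trans.
- by move=> ?; apply: ltnn.
- apply: sorted_filter; first by move=> ? ? ?; apply: ltn_trans.
  by have := iota_ltn_sorted 0 N; rewrite -val_enum_ord sorted_map.
- rewrite sorted_map; apply: (@sub_sorted _ (fun j k : 'I_m => (j < k)%N)).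
    by move=> j k; apply: pos_lt.
  by have := iota_ltn_sorted 0 m; rewrite -val_enum_ord sorted_map.
move=> l; rewrite mem_filter mem_enum andbT /coord.
apply/idP/mapP => [|[j _ ->]]; last by rewrite posK eqxx.
by case: eqP => // <- _; exists (inv l).2; rewrite ?mem_enum ?invK.
Qed.

(** Each derivative in turn acts only on the factor whose block contains its variable. *)
Lemma partials_prod (q : 'I_N -> nat) (F : G -> 'rV[K]_m -> K) :
  partials q (fun v => \prod_g F g (\row_j v 0 (pos g j))) =
  fun v => \prod_g partials (q \o pos g) (F g) (\row_j v 0 (pos g j)).
Proof.
(* The factor [g] after the derivatives listed in [s], of which only those in block [g] affect it; a
   general [s] permits induction. *)
pose D s g := foldr (fun j => iter (q (pos g j)) (partial j)) (F g)
                    (pmap (coord g) s).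
suff DP s : foldr (fun l => iter (q l) (partial l))
      (fun v => \prod_g F g (\row_j v 0 (pos g j))) s =
    fun v => \prod_g D s g (\row_j v 0 (pos g j)).
  rewrite /partials DP; apply/funext => v; apply: eq_bigr => g _.
  by rewrite /D pmap_coord_enum.
elim: s => [|l s IHs] //=; rewrite {}IHs.
(* The intermediate state in which [k] of the [q l] derivatives in variable [l] have been taken. *)
pose E k g := if g == (inv l).1 then iter k (partial (inv l).2) (D s g)
              else D s g.
have -> : D (l :: s) = E (q l).
  apply/funext => g; rewrite /D /E /= /coord [g == _]eq_sym.
  by case: eqP => //= <-; rewrite invK.
elim: (q l) => [|k IHk].
  by apply/funext => v; apply: eq_bigr => g _; rewrite /E; case: ifP.
rewrite /= {}IHk.
have EP k' v : \prod_g E k' g (\row_j v 0 (pos g j)) =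
    (\prod_(g | g != (inv l).1) D s g (\row_j v 0 (pos g j))) *
    iter k' (partial (inv l).2) (D s (inv l).1)
         (\row_j v 0 (pos (inv l).1 j)).
  rewrite (bigD1 (inv l).1) //= mulrC /E eqxx; congr (_ * _).
  by apply: eq_bigr => g /negPf ->.
under eq_fun do rewrite EP.
(* The factors of the other blocks do not contain variable [l]: [inv] determines the block of
   [l]. *)
rewrite partialM_cst; last first.
  move=> h v; apply: eq_bigr => g gl; congr (D s g _).
  apply/rowP => j; rewrite !mxE /=.
  case: eqP => [e|]; last by rewrite mulr0 add0r.
  by rewrite -e posK /= eqxx in gl.
apply/funext => v; rewrite EP /=; congr (_ * _).
by rewrite -[X in partial X _ _](invK l) partial_rowsub.
Qed.

End Partials.

(* Replaces a dependent family, whose types at comp_param (zpos p) and at p are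
   only propositionally equal, by a plain function with a constraint on tags. *)
Lemma sum_dffun_Tagged (V : nmodType) (I P : finType) (T_ : P -> finType)
    (par : I -> P) (F : {ffun I -> {p : P & T_ p}} -> V) :
  \sum_(s : {dffun forall i, T_ (par i)}) F [ffun i => Tagged T_ (s i)] =
  \sum_(t : {ffun I -> {p : P & T_ p}} | [forall i, tag (t i) == par i]) F t.
Proof.
pose h (s : {dffun forall i, T_ (par i)}) := [ffun i => Tagged T_ (s i)].
have h_inj : injective h.
  move=> s s' /ffunP ss'; apply/ffunP => i; move: (ss' i); rewrite !ffunE.
  exact: eq_from_Tagged.
rewrite -(big_imset F (in2W h_inj)) /=.
apply: eq_bigl => t; apply/imsetP/forallP => [[s _ ->] i|tP].
  by rewrite ffunE.
have /fin_all_exists[s sP] i : exists x : T_ (par i), t i = Tagged T_ x.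
  by move/eqP: (tP i) => <-; exists (tagged (t i)); case: (t i).
by exists [ffun i => s i] => //; apply/ffunP => i; rewrite !ffunE sP.
Qed.

(** * Block structure of the long lists of variables and arguments *)

Section Positions.
Variable d : nat.

(** [None] stands for the block of the [z] variables and [Some i] for [w_i]; all blocks have the
    same size, so they can be treated uniformly. *)
Definition block_pos (g : option 'I_d) (j : 'I_d.+1) : 'I_(d * d.+2).+1 :=
  if g is Some i then wpos i j else zpos j.

Lemma val_zpos (p : 'I_d.+1) : zpos p = (p * d.+2)%N :> nat.
Proof. by rewrite inordK // ltnS leq_mul2r -ltnS ltn_ord orbT. Qed.

Lemma val_wpos (i : 'I_d) (j : 'I_d.+1) : wpos i j = (i * d.+2 + j.+1)%N :> nat.
Proof.
rewrite inordK // ltnS (@leq_trans (i.+1 * d.+2)) ?leq_mul2r ?ltn_ord ?orbT //.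
by rewrite mulSn addnC leq_add2r ltnW // ltnS.
Qed.

Lemma block_pos_lt g (j k : 'I_d.+1) :
  (j < k)%N -> (block_pos g j < block_pos g k)%N.
Proof.
case: g => [i|] jk /=; first by rewrite !val_wpos ltn_add2l.
by rewrite !val_zpos ltn_mul2r.
Qed.

Lemma comp_param_block g j : comp_param (block_pos g j) = j.
Proof. by case: g => [i|]; rewrite (comp_param_zpos, comp_param_wpos). Qed.

(** Both sides have [(d+1)^2] elements, so injectivity suffices. [comp_param] recovers [j]; modulo
    [d+2], a [z] position is [0] and a [w] position is [j+1], which is nonzero. *)
Lemma block_pos_bij : bijective (fun gj => block_pos gj.1 gj.2).
Proof.
apply: inj_card_bij => [[g j] [g' j'] /= e|]; last first.
  by rewrite card_prod card_option !card_ord comp_params_sqr mulnn.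
have jj' : j = j' by rewrite -(comp_param_block g j) e comp_param_block.
congr (_, _) => //; move: e; rewrite {}jj' => /(congr1 val) /=.
have jlt : (j'.+1 < d.+2)%N by rewrite ltnS.
case: g g' => [i|] [i'|] //=; rewrite ?val_wpos ?val_zpos.
- by move/eqP; rewrite eqn_add2r eqn_mul2r /= => /eqP/val_inj ->.
- by move/(congr1 (modn^~ d.+2)); rewrite modnMDl modnMl modn_small.
- by move/(congr1 (modn^~ d.+2)); rewrite modnMDl modnMl modn_small.
Qed.

Variables (K : numFieldType) (n : nat).

(** The word is cut into [d] chunks of [d+2] factors; the identities at both ends of a chunk
    disappear. *)
Lemma prod_comp_arg (Y : 'I_d -> 'M[K]_n) (U : 'I_(d * d.+2).+1 -> 'M[K]_n) :
  U ord0 * \prod_(l < d * d.+2) (comp_arg Y l * U (lift ord0 l)) =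
  U (zpos ord0) * \prod_(i < d)
    (U (wpos i ord0) * \prod_(j < d) (Y j * U (wpos i (lift ord0 j)))
     * U (zpos (lift ord0 i))).
Proof.
congr (U _ * _); first by apply: val_inj; rewrite /= val_zpos.
(* Natural number indices allow the product to be cut at multiples of [d.+2]. *)
pose G l := nth 1%:M (comp_args Y) l * U (inord l.+1).
transitivity (\prod_(0 <= l < d * d.+2) G l).
  rewrite big_mkord; apply: eq_bigr => l _; congr (_ * U _).
  by apply: val_inj; rewrite /= inordK // ltnS ltn_ord.
rewrite big_nat_mul big_mkord; apply: eq_bigr => i _.
rewrite -{1}[(i * d.+2)%N]add0n big_addn mulSn addnK.
have GE (k : nat) : (k < d.+2)%N -> G (k + i * d.+2)%N =
    nth 1%:M (1%:M :: rcons [seq Y j | j <- enum 'I_d] 1%:M) k *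
    U (inord (i * d.+2 + k.+1)).
  move=> kd; rewrite /G addnC addnS; congr (_ * _).
  rewrite (@nth_flatten_const _ _ 1%:M i
    (fun=> 1%:M :: rcons [seq Y j | j <- enum 'I_d] 1%:M)) //.
    by move=> _; rewrite /= size_rcons size_map size_enum_ord.
  by rewrite size_enum_ord.
have nthY (j : 'I_d) : nth 1%:M (rcons [seq Y k | k <- enum 'I_d] 1%:M) j = Y j.
  rewrite nth_rcons size_map size_enum_ord ltn_ord (nth_map j) ?nth_ord_enum //.
  by rewrite size_enum_ord.
have nth1 : nth 1%:M (rcons [seq Y k | k <- enum 'I_d] 1%:M) d = 1%:M.
  by rewrite nth_rcons size_map size_enum_ord ltnn eqxx.
(* The first factor of the chunk gives [w_(i,0)], the last gives the next [z], and those between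
   carry the [Y j]. *)
rewrite big_nat_recl // big_nat_recr // !GE // [nth _ (_ :: _) d.+1]nth1 !mul1r.
rewrite /= mulrA; congr (U _ * _ * U _).
  rewrite big_mkord; apply: eq_bigr => j _.
  rewrite GE; last by rewrite !ltnS ltnW.
  by rewrite [nth _ (_ :: _) _]nthY /wpos lift0.
rewrite /zpos lift0 mulSn; congr inord; lia.
Qed.

End Positions.

Lemma big_optionE (R : Type) (idx : R) (op : Monoid.com_law idx) (I : finType)
    (F : option I -> R) :
  \big[op/idx]_g F g = op (F None) (\big[op/idx]_i F (Some i)).
Proof.
rewrite (bigD1 None) //=; congr (op _ _).
rewrite (reindex_omap Some id) /=; last by case.
by apply: eq_bigl => i; rewrite eqxx.
Qed.

Lemma scalemx_prod (K : comPzRingType) (n : nat) (I : Type) (r : seq I)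
    (c : I -> K) (M : I -> 'M[K]_n) :
  \prod_(i <- r) (c i *: M i) = (\prod_(i <- r) c i) *: \prod_(i <- r) M i.
Proof.
elim/big_rec3: _ => [|i x y z _ ->]; first by rewrite scale1r.
by rewrite -[LHS]scalemxAl -[_ *m _]scalemxAr scalerA.
Qed.

(** * Comparison of the two operator integrals *)

Section Composition.
Variables (K : numFieldType) (n d : nat).
Variables (X : 'I_d.+1 -> 'M[K]_n) (J : forall p, jordan_data (X p)).

Local Notation T := {p : 'I_d.+1 & jindex (J p)}.

Let tS (u : T) : 'M[K]_n := jS (tagged u).

Let tcoef r (b : 'rV[K]_r -> K) (t : 'I_r -> T) : K :=
  partials (fun l => jexp (tagged (t l))) b (\row_l jlambda (tagged (t l)))
    / \prod_l (jexp (tagged (t l)))`!%:R.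

Let tprod r (Y : 'I_r -> 'M[K]_n) (t : 'I_r.+1 -> T) : 'M[K]_n :=
  tS (t ord0) * \prod_(l < r) (Y l * tS (t (lift ord0 l))).

(** Puts the long and the short integrals in one form, over plain functions into [T], so that long
    families can be cut and glued; [par = id] gives the short ones. *)
Lemma gmoi_Tagged r (par : 'I_r.+1 -> 'I_d.+1) b (Y : 'I_r -> 'M[K]_n) :
  gmoi (fun l => X (par l)) (fun l => J (par l)) b Y =
  \sum_(t : {ffun 'I_r.+1 -> T} | [forall l, tag (t l) == par l])
    tcoef b t *: tprod Y t.
Proof.
rewrite -(sum_dffun_Tagged (T_ := fun p => jindex (J p)) par
  (fun t => tcoef b t *: tprod Y t)) /gmoi.
apply: eq_bigr => s _; rewrite /tcoef /tprod /tS ffunE.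
congr (_ *: _); [congr (_ / _) | congr (_ * _)].
- congr (partials _ _ _); first by apply/funext => l; rewrite ffunE.
  by apply/rowP => l; rewrite !mxE ffunE.
- by apply: eq_bigr => l _; rewrite ffunE.
- by apply: eq_bigr => l _; rewrite ffunE.
Qed.

Lemma comp_funE (f : 'rV[K]_d.+1 -> K) (b : 'I_d -> 'rV[K]_d.+1 -> K) :
  comp_fun f b = fun v => \prod_g oapp b f g (\row_j v 0 (block_pos g j)).
Proof. by apply/funext => v; rewrite big_optionE. Qed.

(** The derivatives factor by [partials_prod]; the factorials are regrouped along
    [block_pos_bij]. *)
Lemma tcoef_comp_fun (f : 'rV[K]_d.+1 -> K) (b : 'I_d -> 'rV[K]_d.+1 -> K)
    (t : 'I_(d * d.+2).+1 -> T) :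
  tcoef (comp_fun f b) t =
  tcoef f (t \o @zpos d) * \prod_(i < d) tcoef (b i) (t \o wpos i).
Proof.
have [inv posK invK] := block_pos_bij d.
have posK' g j : inv (block_pos g j) = (g, j) by exact: (posK (g, j)).
rewrite /tcoef comp_funE (partials_prod posK' invK (@block_pos_lt d)).
have -> : \prod_l (jexp (tagged (t l)))`!%:R =
    \prod_g \prod_j (jexp (tagged (t (block_pos g j))))`!%:R :> K.
  rewrite pair_bigA (reindex (fun gj => block_pos gj.1 gj.2)) //.
  by apply: onW_bij; apply: block_pos_bij.
rewrite -prodf_div.
transitivity (\prod_g tcoef (oapp b f g) (t \o block_pos g)).
  apply: eq_bigr => g _; congr (partials _ _ _ / _).
  by apply/rowP => j; rewrite !mxE.
exact: big_optionE.
Qed.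

Lemma gmoi_comp (Y : 'I_d -> 'M[K]_n) (f : 'rV[K]_d.+1 -> K)
    (b : 'I_d -> 'rV[K]_d.+1 -> K) :
  gmoi (fun l => X (comp_param l)) (fun l => J (comp_param l))
       (comp_fun f b) (comp_arg Y)
  = gmoi X J f (fun i => gmoi X J (b i) Y).
Proof.
have [inv posK invK] := block_pos_bij d.
pose A : pred {ffun 'I_d.+1 -> T} := fun w => [forall j, tag (w j) == j].
have gmoiE c Z : gmoi X J c Z = \sum_(w | A w) tcoef c w *: tprod Z w.
  exact: (gmoi_Tagged id).
pose S := ({ffun 'I_d.+1 -> T} * {ffun 'I_d -> {ffun 'I_d.+1 -> T}})%type.
pose block (u : S) g := oapp u.2 u.1 g.
(* A long family amounts to one family for [f] and one for each [b i]. *)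
pose glue (u : S) : {ffun 'I_(d * d.+2).+1 -> T} :=
  [ffun l => block u (inv l).1 (inv l).2].
have glueE u g j : glue u (block_pos g j) = block u g j.
  by rewrite ffunE (posK (g, j)).
have glue_bij : bijective glue.
  exists (fun t : {ffun 'I_(d * d.+2).+1 -> T} =>
    ([ffun j => t (block_pos None j)],
     [ffun i => [ffun j => t (block_pos (Some i) j)]])) => [[z w]|t].
    congr (_, _); apply/ffunP => i; rewrite ffunE ?glueE //.
    by apply/ffunP => j; rewrite ffunE glueE.
  apply/ffunP => l; rewrite -[l]invK; case: (inv l) => g j /=; rewrite glueE.
  by case: g => [i|]; rewrite /block /= !ffunE.
rewrite gmoi_Tagged (reindex glue) /=; last exact: onW_bij.
rewrite gmoiE.
(* The tag constraint on the glued family splits into one per block. *)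
transitivity (\sum_(u : S | A u.1 && (u.2 \in ffun_on A))
  (tcoef f u.1 * \prod_i tcoef (b i) (u.2 i)) *:
  (tS (u.1 ord0) * \prod_(i < d) (tprod Y (u.2 i) * tS (u.1 (lift ord0 i))))).
  apply: eq_big => [u|u _].
    apply/forallP/andP => [uP|[zA wA] l].
      have {}uP g j : tag (block u g j) == j.
        by rewrite -glueE -{2}(comp_param_block g j) uP.
      split; first by apply/forallP => j; exact: (uP None).
      by apply/ffun_onP => i; apply/forallP => j; exact: (uP (Some i)).
    rewrite -[l]invK; case: (inv l) => g j /=; rewrite glueE comp_param_block.
    case: g => [i|] /=; last exact: (forallP zA).
    by move/ffun_onP: wA => /(_ i)/forallP.
  rewrite tcoef_comp_fun /tprod (prod_comp_arg Y (fun l => tS (glue u l))).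
  have glue0 : glue u \o @zpos d = u.1.
    by apply/funext => j; exact: (glueE u None).
  have glueS i : glue u \o wpos i = u.2 i.
    by apply/funext => j; exact: (glueE u (Some i)).
  rewrite glue0; congr (_ *: _); [congr (_ * _) | congr (_ * _)].
  - by apply: eq_bigr => i _; rewrite glueS.
  - by rewrite -(glueE u None).
  apply: eq_bigr => i _; rewrite -(glueE u (Some i)) -(glueE u None).
  congr (_ * _ * _); apply: eq_bigr => j _.
  by rewrite -(glueE u (Some i)).
rewrite -(pair_big A (mem (ffun_on A)) (fun z w =>
  (tcoef f z * \prod_i tcoef (b i) (w i)) *:
  (tS (z ord0) * \prod_(i < d) (tprod Y (w i) * tS (z (lift ord0 i)))))) /=.
apply: eq_bigr => z _; rewrite [in RHS]/tprod.
under [in RHS]eq_bigr do rewrite gmoiE big_distrl /=.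
(* Distributivity: the product of the inner sums becomes a sum over choices [w] of one inner family
   per [i]. *)
rewrite bigA_distr_big mulr_sumr scaler_sumr; apply: eq_bigr => w _.
rewrite -scalerA; congr (_ *: _).
under [in RHS]eq_bigr do rewrite -[_ * _]scalemxAl.
by rewrite scalemx_prod; exact: scalemxAr.
Qed.

End Composition.

Theorem proposition2 (R : realType) (n zeta : nat) (zeta_ge1 : (1 <= zeta)%N)
    (X : 'I_zeta.+1 -> 'M[R[i]]_n) (J : forall p, jordan_data (X p))
    (Y : 'I_zeta -> 'M[R[i]]_n)
    (f : 'rV[R[i]]_zeta.+1 -> R[i])
    (beta : 'I_zeta -> 'rV[R[i]]_zeta.+1 -> R[i])
    (f_def : gmoi_defined X f)
    (beta_def : forall i, gmoi_defined X (beta i)) :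
  gmoi (fun l => X (comp_param l)) (fun l => J (comp_param l))
       (comp_fun f beta) (comp_arg Y)
  = gmoi X J f (fun i => gmoi X J (beta i) Y).
Proof. exact: gmoi_comp. Qed.
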